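(* Let $m,n$ be positive integers, let $c\in\mathbb{R}^n$, $d\in\mathbb{R}$, $A\in\mathbb{R}^{m\times n}$, $b\in\mathbb{R}^m$, and let $f:\mathbb{R}^n\to\mathbb{R}$ be the second-order cone function $f(x)=c^Tx+d-\|Ax+b\|$. Then $f$ is concave. Furthermore, $f$ is strictly concave if and only if $\operatorname{rank}(A)=n$ and $b\notin\operatorname{col}(A)$.
   Context: $\|\cdot\|$ is the Euclidean norm and $\operatorname{col}(A)$ is the column space of $A$. A function $f:\mathbb{R}^n\to\mathbb{R}$ is concave if $f((1-t)x_0+tx_1)\ge(1-t)f(x_0)+tf(x_1)$ for all $x_0\ne x_1$ in $\mathbb{R}^n$ and all $t\in(0,1)$; it is strictly concave if this inequality is always strict. *)

(* Defs.v *)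
From mathcomp Require Import all_boot all_order all_algebra.
From mathcomp Require Import reals.

Set Implicit Arguments.
Unset Strict Implicit.
Unset Printing Implicit Defensive.

Import Order.TTheory GRing.Theory Num.Theory.
Local Open Scope ring_scope.

(* The canonical norm `|v| on matrices (mx_norm) is the sup norm, so
   the Euclidean norm is defined explicitly. *)
Definition enorm (R : realType) (m : nat) (v : 'cV[R]_m) : R :=
  Num.sqrt (\sum_(i < m) v i 0 ^+ 2).

Definition concave (R : realType) (n : nat) (f : 'cV[R]_n -> R) : Prop :=
  forall (x0 x1 : 'cV[R]_n) (t : R), x0 <> x1 -> 0 < t -> t < 1 ->
    (1 - t) * f x0 + t * f x1 <= f ((1 - t) *: x0 + t *: x1).

Definition strictly_concave (R : realType) (n : nat)
    (f : 'cV[R]_n -> R) : Prop :=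
  forall (x0 x1 : 'cV[R]_n) (t : R), x0 <> x1 -> 0 < t -> t < 1 ->
    (1 - t) * f x0 + t * f x1 < f ((1 - t) *: x0 + t *: x1).

(* %MS inclusion compares row spaces, hence the transposes: the row space of
   A^T is the column space of A. *)
Definition in_colspace (R : realType) (m n : nat) (A : 'M[R]_(m, n))
    (b : 'cV[R]_m) : bool :=
  (b^T <= A^T)%MS.

Definition soc_fun (R : realType) (m n : nat) (c : 'cV[R]_n) (d : R)
    (A : 'M[R]_(m, n)) (b : 'cV[R]_m) (x : 'cV[R]_n) : R :=
  (c^T *m x) 0 0 + d - enorm (A *m x + b).

(* Main.v *)
Require Import Defs.
From mathcomp Require Import all_boot all_order all_algebra.
From mathcomp Require Import reals.
From mathcomp Require Import ring lra.

Set Implicit Arguments.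
Unset Strict Implicit.
Unset Printing Implicit Defensive.

Import Order.TTheory GRing.Theory Num.Theory.
Local Open Scope ring_scope.

(** Put u = A x0 + b and v = A x1 + b. The affine part of f contributes
    equally to both sides of the concavity inequality, and A _ + b maps convex
    combinations to convex combinations, so (strict) concavity along x0, x1
    says exactly that the triangle inequality
      |(1 - t) u + t v| <= (1 - t) |u| + t |v|
    holds (strictly); this is [soc_fun_gap]. Hence f is concave, and f can fail
    to be strictly concave only through the equality case of the triangle
    inequality, |v| u = |u| v ([enorm_add_eq]).

    If A is injective and b is not in col(A), this case is impossible for
    x0 <> x1: it reads A (|v| x0 - |u| x1) = (|u| - |v|) b, so |u| = |v| because
    b is not in col(A); then |u| A (x0 - x1) = 0, where |u| <> 0, again because
    b is not in col(A), and injectivity gives x0 = x1.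

    Conversely, f is affine along a segment in each remaining case: a segment
    in the direction of a nonzero kernel vector of A, on which A x + b is
    constant, or, if b = A w, any segment starting at the zero -w of A x + b,
    on which the norm is homogeneous. *)

Section EuclideanNorm.
Variables (R : realType) (m : nat).
Implicit Types u v : 'cV[R]_m.

Lemma enorm_ge0 u : 0 <= enorm u.
Proof. exact: sqrtr_ge0. Qed.

Lemma enorm_sqr u : enorm u ^+ 2 = \sum_(i < m) u i 0 ^+ 2.
Proof. by rewrite sqr_sqrtr // sumr_ge0 // => i _; exact: sqr_ge0. Qed.

Lemma enorm_eq0 u : enorm u = 0 -> u = 0.
Proof.
move=> u0; have /eqP := enorm_sqr u.
rewrite u0 expr0n /= eq_sym psumr_eq0 => [/allP u_eq0|i _]; last exact: sqr_ge0.
apply/matrixP => i j; rewrite ord1 mxE.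
by have := u_eq0 i (mem_index_enum i); rewrite /= sqrf_eq0 => /eqP.
Qed.

Lemma enorm0 : enorm (0 : 'cV[R]_m) = 0.
Proof.
by rewrite /enorm big1 ?sqrtr0 // => i _; rewrite mxE expr0n.
Qed.

Lemma enormZ (a : R) u : 0 <= a -> enorm (a *: u) = a * enorm u.
Proof.
move=> a_ge0; apply/eqP.
rewrite -(@eqrXn2 _ 2) ?mulr_ge0 ?enorm_ge0 // exprMn !enorm_sqr mulr_sumr.
by apply/eqP/eq_bigr => i _; rewrite mxE exprMn.
Qed.

(** The deficit in the triangle inequality, weighted by |u| |v|, is a square:
    both sides equal 2 |u| |v| (|u| |v| - <u, v>). This yields the inequality
    and its equality case at once, without a separate Cauchy-Schwarz lemma. *)
Lemma enorm_triangle_deficit u v :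
  enorm u * enorm v * ((enorm u + enorm v) ^+ 2 - enorm (u + v) ^+ 2)
  = enorm (enorm v *: u - enorm u *: v) ^+ 2.
Proof.
pose dot := \sum_(i < m) u i 0 * v i 0.
have add_sqr : enorm (u + v) ^+ 2 = enorm u ^+ 2 + dot *+ 2 + enorm v ^+ 2.
  rewrite !enorm_sqr -sumrMnl -!big_split /=.
  by apply: eq_bigr => i _; rewrite mxE sqrrD.
have sub_sqr a b' : enorm (a *: u - b' *: v) ^+ 2
    = a ^+ 2 * enorm u ^+ 2 - a * b' * dot *+ 2 + b' ^+ 2 * enorm v ^+ 2.
  rewrite !enorm_sqr !mulr_sumr -sumrMnl -sumrB -big_split /=.
  by apply: eq_bigr => i _; rewrite !mxE; ring.
by rewrite add_sqr sub_sqr; ring.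
Qed.

Lemma enorm_add_le u v : enorm (u + v) <= enorm u + enorm v.
Proof.
have [/enorm_eq0 ->|u_neq0] := eqVneq (enorm u) 0; first by rewrite enorm0 !add0r.
have [/enorm_eq0 ->|v_neq0] := eqVneq (enorm v) 0; first by rewrite enorm0 !addr0.
have uv_gt0 : 0 < enorm u * enorm v.
  by rewrite mulr_gt0 // lt_def ?u_neq0 ?v_neq0 enorm_ge0.
rewrite -ler_sqr ?nnegrE ?addr_ge0 ?enorm_ge0 //.
rewrite -subr_ge0 -(pmulr_rge0 _ uv_gt0).
by rewrite enorm_triangle_deficit sqr_ge0.
Qed.

Lemma enorm_add_eq u v :
  enorm (u + v) = enorm u + enorm v -> enorm v *: u = enorm u *: v.
Proof.
move=> eq_uv; have /esym/eqP := enorm_triangle_deficit u v.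
rewrite eq_uv subrr mulr0 sqrf_eq0 => /eqP/enorm_eq0/eqP.
by rewrite subr_eq0 => /eqP.
Qed.

End EuclideanNorm.

Section ColumnSpace.
Variables (R : realType) (m n : nat) (A : 'M[R]_(m, n)).

Lemma in_colspaceP (b : 'cV[R]_m) :
  reflect (exists w, b = A *m w) (in_colspace A b).
Proof.
apply: (iffP submxP) => [[w bE]|[w ->]].
  by exists w^T; apply: trmx_inj; rewrite trmx_mul trmxK.
by exists w^T; rewrite trmx_mul.
Qed.

Lemma full_col_rankP :
  (\rank A = n) <-> (forall z : 'cV[R]_n, A *m z = 0 -> z = 0).
Proof.
rewrite -mxrank_tr; split => [rkA z Az0|injA].
  apply: trmx_inj; apply: (row_free_inj (introT eqP rkA)).
  by rewrite -trmx_mul Az0 !trmx0 mul0mx.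
apply/eqP; rewrite -/(row_free _) -kermx_eq0.
apply/rowV0P => z /sub_kermxP zA0.
apply: trmx_inj; rewrite trmx0; apply: injA.
by apply: trmx_inj; rewrite trmx_mul trmxK zA0 trmx0.
Qed.

End ColumnSpace.

Section SecondOrderCone.
Variables (R : realType) (m n : nat).
Variables (c : 'cV[R]_n) (d : R) (A : 'M[R]_(m, n)) (b : 'cV[R]_m).
Implicit Types (x : 'cV[R]_n) (t : R).

Lemma soc_fun_gap x0 x1 t :
  soc_fun c d A b ((1 - t) *: x0 + t *: x1)
    - ((1 - t) * soc_fun c d A b x0 + t * soc_fun c d A b x1)
  = (1 - t) * enorm (A *m x0 + b) + t * enorm (A *m x1 + b)
    - enorm ((1 - t) *: (A *m x0 + b) + t *: (A *m x1 + b)).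
Proof.
have -> : (1 - t) *: (A *m x0 + b) + t *: (A *m x1 + b)
    = A *m ((1 - t) *: x0 + t *: x1) + b.
  rewrite mulmxDr -!scalemxAr !scalerDr addrACA -scalerDl subrK.
  by rewrite scale1r.
rewrite /soc_fun mulmxDr -!scalemxAr.
by rewrite !mxE; ring.
Qed.

Lemma soc_fun_concave : concave (soc_fun c d A b).
Proof.
move=> x0 x1 t _ t_gt0 t_lt1.
rewrite -subr_ge0 soc_fun_gap subr_ge0.
by rewrite -!enormZ ?enorm_add_le ?subr_ge0 // ltW.
Qed.

Lemma soc_fun_strictly_concave :
  \rank A = n -> ~~ in_colspace A b -> strictly_concave (soc_fun c d A b).
Proof.
move=> /full_col_rankP injA bNcol x0 x1 t x01 t_gt0 t_lt1.
rewrite lt_neqAle soc_fun_concave // andbT.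
apply/eqP => eq_f; apply: x01.
have s_gt0 : 0 < 1 - t by rewrite subr_gt0.
have /esym/eqP := soc_fun_gap x0 x1 t.
rewrite -eq_f subrr subr_eq0 -!enormZ ?ltW // => /eqP/esym/enorm_add_eq.
rewrite !enormZ ?ltW //; set u := A *m x0 + b; set v := A *m x1 + b.
move=> eq_scaled.
(* The weights enter both sides only through the nonzero factor t (1 - t). *)
have eq_uv : enorm v *: u = enorm u *: v.
  have st_neq0 : t * (1 - t) != 0 by rewrite mulf_neq0 ?gt_eqF.
  apply: (scalerI st_neq0); rewrite !scalerA.
  move: eq_scaled; rewrite !scalerA => eq_scaled.
  rewrite mulrAC eq_scaled; congr (_ *: _); ring.
have eq_b : (enorm u - enorm v) *: b = A *m (enorm v *: x0 - enorm u *: x1).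
  rewrite mulmxBr -!scalemxAr scalerBl.
  move/eqP: eq_uv; rewrite !scalerDr -subr_eq0 opprD addrACA addr_eq0.
  by move=> /eqP ->; rewrite opprB.
have eq_norm : enorm u = enorm v.
  apply/eqP; rewrite -subr_eq0; apply: contraNT bNcol => uv_neq0.
  apply/in_colspaceP; exists ((enorm u - enorm v)^-1 *:
    (enorm v *: x0 - enorm u *: x1)).
  by rewrite -scalemxAr -eq_b scalerA mulVf // scale1r.
have u_neq0 : enorm u != 0.
  apply: contraNneq bNcol => /enorm_eq0/eqP; rewrite addr_eq0 => /eqP Ax0.
  by apply/in_colspaceP; exists (- x0); rewrite mulmxN Ax0 opprK.
apply/eqP; rewrite -subr_eq0; apply/eqP/injA/(scalerI u_neq0).
by rewrite scaler0 scalemxAr scalerBr {1}eq_norm -eq_b eq_norm subrr scale0r.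
Qed.

(** The necessity of both conditions needs only t = 1/2: a segment on which f
    is affine contradicts the strict inequality at its midpoint. *)
Lemma strictly_concave_enorm_midpoint x0 x1 :
  strictly_concave (soc_fun c d A b) -> x0 <> x1 ->
  enorm (2^-1 *: (A *m x0 + b) + 2^-1 *: (A *m x1 + b))
  < 2^-1 * enorm (A *m x0 + b) + 2^-1 * enorm (A *m x1 + b).
Proof.
move=> sc x01; have half : 1 - 2^-1 = 2^-1 :> R by lra.
have lt_f := sc x0 x1 2^-1 x01 ltac:(lra) ltac:(lra).
by move: lt_f; rewrite -subr_gt0 soc_fun_gap half subr_gt0.
Qed.

Lemma strictly_concave_full_col_rank :
  strictly_concave (soc_fun c d A b) -> \rank A = n.
Proof.
move=> sc; apply/full_col_rankP => z Az0; apply/eqP/negPn/negP => z_neq0.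
have /(strictly_concave_enorm_midpoint sc) : 0 <> z.
  by move=> z0; rewrite -z0 eqxx in z_neq0.
have half_half : 2^-1 + 2^-1 = 1 :> R by lra.
by rewrite Az0 mulmx0 add0r -scalerDl -mulrDl half_half scale1r mul1r ltxx.
Qed.

Lemma strictly_concave_notin_colspace :
  (0 < n)%N -> strictly_concave (soc_fun c d A b) -> ~~ in_colspace A b.
Proof.
move=> n_gt0 sc; apply/in_colspaceP => -[w bE].
pose e : 'cV[R]_n := const_mx 1.
have e_neq0 : e <> 0.
  move=> /matrixP /(_ (Ordinal n_gt0) 0).
  by rewrite !mxE => /eqP; rewrite oner_eq0.
have /(strictly_concave_enorm_midpoint sc) : - w <> e - w.
  by move=> /(congr1 (+%R^~ w)) /=; rewrite addNr subrK => /esym.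
rewrite mulmxBr mulmxN -bE subrK addNr enorm0 scaler0 mulr0 !add0r.
by rewrite enormZ ?ltxx // invr_ge0 ler0n.
Qed.

End SecondOrderCone.

Theorem theorem5 (R : realType) (m n : nat) (m_gt0 : (0 < m)%N)
    (n_gt0 : (0 < n)%N) (c : 'cV[R]_n) (d : R) (A : 'M[R]_(m, n))
    (b : 'cV[R]_m) :
  concave (soc_fun c d A b) /\
  (strictly_concave (soc_fun c d A b) <->
     \rank A = n /\ ~~ in_colspace A b).
Proof.
split; first exact: soc_fun_concave.
split=> [sc|[rkA bNcol]]; last exact: soc_fun_strictly_concave.
split; first exact: strictly_concave_full_col_rank sc.
exact: strictly_concave_notin_colspace n_gt0 sc.
Qed.
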